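(* Let $V$ and $W$ be function systems and let $\Phi:V\to W$ be a unital positive linear map. The following are equivalent: (i) the map $\mathrm{id}_A\otimes\Phi: A\otimes_{\min}V\to A\otimes_{\max}W$ is positive for any function system $A$; (ii) the map $\mathrm{id}_E\otimes\Phi: E\otimes_{\min}V\to E\otimes_{\max}W$ is positive for any finite-dimensional function system $E$; (iii) there exist nets of unital positive linear maps $\varphi_\lambda:V\to\ell^\infty_{n_\lambda}$ and $\psi_\lambda:\ell^\infty_{n_\lambda}\to W$ (indexed by the same directed set) such that $\psi_\lambda\circ\varphi_\lambda$ converges to $\Phi$ in the point-norm topology, i.e. $\|\psi_\lambda(\varphi_\lambda(v))-\Phi(v)\|\to0$ for every $v\in V$.
   Context: A function system is a real vector space $V$ with a (convex) cone $V^+$, $V^+\cap -V^+=\{0\}$ ($v\ge w$ iff $v-w\in V^+$), and an Archimedean order unit $e_V$: for each $v\in V$ there is $r>0$ with $re_V\ge v$, and $\varepsilon e_V+v\in V^+$ for all $\varepsilon>0$ implies $v\in V^+$. It carries the order norm $\|v\|=\inf\{r>0:-re_V\le v\le re_V\}$. A linear map is positive if it maps positive elements to positive elements, unital if it maps order unit to order unit. A state on $V$ is a positive linear functional $f:V\to\mathbb R$ with $f(e_V)=1$; $S(V)$ is the set of states. $\ell^\infty_n$ is $\mathbb R^n$ with coordinatewise order and order unit $(1,\dots,1)$ ($n\ge 0$, with $\ell^\infty_0=\{0\}$). Tensor products: on the algebraic tensor product $V\otimes W$ with order unit $e_V\otimes e_W$, the function system $V\otimes_{\min}W$ has positive cone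 $\{z: (f\otimes g)(z)\ge0\ \forall f\in S(V), g\in S(W)\}$, and the function system $V\otimes_{\max}W$ has positive cone $\{z:\forall\varepsilon>0,\ z+\varepsilon e_V\otimes e_W\in V^+\otimes W^+\}$, where $V^+\otimes W^+$ is the set of finite sums $\sum_i v_i\otimes w_i$ with $v_i\in V^+$, $w_i\in W^+$. *)

(* Defs.v *)
From HB Require Import structures.
From mathcomp Require Import all_boot all_order all_algebra generic_quotient.
From mathcomp Require Import sesquilinear.
From mathcomp Require Import all_classical all_reals.

Set Implicit Arguments.
Unset Strict Implicit.
Unset Printing Implicit Defensive.

Import Order.TTheory GRing.Theory Num.Theory.
Local Open Scope classical_set_scope.
Local Open Scope ring_scope.
Local Open Scope quotient_scope.

(* V (x) W for modules V, W of arbitrary dimension over a commutative ring K: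
   the list [:: (v1, w1); ...; (vn, wn)] stands for the formal sum
   v1 (x) w1 + ... + vn (x) wn, and tensor_eq is the congruence generated by
   commutativity of formal sums and the relations defining a balanced
   product. *)
Section Tensor.
Variables (K : comNzRingType) (V W : lmodType K).
Implicit Types (s t : seq (V * W)) (v : V) (w : W).

Inductive tensor_eq : seq (V * W) -> seq (V * W) -> Prop :=
| teq_refl s : tensor_eq s s
| teq_sym s t : tensor_eq s t -> tensor_eq t s
| teq_trans s t u : tensor_eq s t -> tensor_eq t u -> tensor_eq s u
| teq_cat s s' t t' :
    tensor_eq s s' -> tensor_eq t t' -> tensor_eq (s ++ t) (s' ++ t')
| teq_catC s t : tensor_eq (s ++ t) (t ++ s)
| teq_Dl v v' w : tensor_eq [:: (v + v', w)] [:: (v, w); (v', w)]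
| teq_Dr v w w' : tensor_eq [:: (v, w + w')] [:: (v, w); (v, w')]
| teq_Z a v w : tensor_eq [:: (a *: v, w)] [:: (v, a *: w)]
| teq_0 w : tensor_eq [:: (0, w)] [::].

Definition tensor_eqb s t : bool := `[< tensor_eq s t >].

Fact tensor_eqb_refl : reflexive tensor_eqb.
Proof. by move=> s; apply/asboolP; exact: teq_refl. Qed.

Fact tensor_eqb_sym : symmetric tensor_eqb.
Proof. by move=> s t; apply/asboolP/asboolP; exact: teq_sym. Qed.

Fact tensor_eqb_trans : transitive tensor_eqb.
Proof.
by move=> t s u /asboolP st /asboolP tu; apply/asboolP; exact: teq_trans st tu.
Qed.

Canonical tensor_equiv :=
  EquivRel tensor_eqb tensor_eqb_refl tensor_eqb_sym tensor_eqb_trans.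

Definition tensor := {eq_quot tensor_equiv}.
HB.instance Definition _ := Choice.on tensor.

Definition tclass s : tensor := \pi_({eq_quot tensor_equiv}) s.
Definition trepr (z : tensor) : seq (V * W) := repr (z : {eq_quot tensor_equiv}).

Lemma treprK z : tclass (trepr z) = z. Proof. exact: reprK. Qed.

Lemma tclassP s t : tclass s = tclass t <-> tensor_eq s t.
Proof.
split=> [/eqmodP /asboolP //|st]; first by apply/eqmodP/asboolP.
Qed.

Lemma trepr_eq s : tensor_eq (trepr (tclass s)) s.
Proof. by apply/tclassP; rewrite treprK. Qed.

Definition tadd (x y : tensor) : tensor := tclass (trepr x ++ trepr y).
Definition tscale (a : K) (x : tensor) : tensor :=
  tclass [seq (a *: p.1, p.2) | p <- trepr x].

Lemma taddE s t : tadd (tclass s) (tclass t) = tclass (s ++ t).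
Proof. by apply/tclassP; apply: teq_cat; exact: trepr_eq. Qed.

Lemma tensor_eq_scale a s t : tensor_eq s t ->
  tensor_eq [seq (a *: p.1, p.2) | p <- s] [seq (a *: p.1, p.2) | p <- t].
Proof.
elim=> {s t} /=.
- by move=> s; exact: teq_refl.
- by move=> s t _ h; exact: teq_sym h.
- by move=> s t u _ h _ h'; exact: teq_trans h h'.
- by move=> s s' t t' _ h _ h'; rewrite !map_cat; exact: teq_cat h h'.
- by move=> s t; rewrite !map_cat; exact: teq_catC.
- by move=> v v' w; rewrite scalerDr; exact: teq_Dl.
- by move=> v w w'; exact: teq_Dr.
- by move=> b v w; rewrite scalerA mulrC -scalerA; exact: teq_Z.
- by move=> w; rewrite scaler0; exact: teq_0.
Qed.

Lemma tscaleE a s : tscale a (tclass s) = tclass [seq (a *: p.1, p.2) | p <- s].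
Proof. by apply/tclassP; apply: tensor_eq_scale; exact: trepr_eq. Qed.

Lemma tensorW (P : tensor -> Prop) : (forall s, P (tclass s)) -> forall z, P z.
Proof. by move=> h z; rewrite -(treprK z). Qed.

Fact taddA : associative tadd.
Proof.
elim/tensorW=> s; elim/tensorW=> t; elim/tensorW=> u.
by rewrite !taddE catA.
Qed.

Fact taddC : commutative tadd.
Proof.
elim/tensorW=> s; elim/tensorW=> t.
by rewrite !taddE; apply/tclassP; exact: teq_catC.
Qed.

Fact tadd0 : left_id (tclass [::]) tadd.
Proof. by elim/tensorW=> s; rewrite taddE. Qed.

Fact taddN : left_inverse (tclass [::]) (tscale (-1)) tadd.
Proof.
elim/tensorW; elim=> [|[v w] s IH]; first by rewrite tscaleE taddE.
rewrite tscaleE /= -cat1s -(cat1s (v, w)) -!taddE -tscaleE.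
rewrite -taddA [tadd (tscale _ _) _]taddC -!taddA (taddC (tclass s)) IH.
rewrite (taddC _ (tclass [::])) tadd0 taddE cat1s.
apply/tclassP; apply: (teq_trans (t := [:: (-1 *: v + v, w)])).
  by apply: teq_sym; exact: teq_Dl.
by rewrite scaleN1r addNr; exact: teq_0.
Qed.

HB.instance Definition _ :=
  GRing.isZmodule.Build tensor taddA taddC tadd0 taddN.

Lemma tclass_cat s t : tclass (s ++ t) = tclass s + tclass t.
Proof. by rewrite -taddE. Qed.

Lemma tclass_nil : tclass [::] = 0. Proof. by []. Qed.

Fact tscaleA a b x : tscale a (tscale b x) = tscale (a * b) x.
Proof.
elim/tensorW: x => s; rewrite !tscaleE -map_comp; congr tclass.
by apply: eq_map => p /=; rewrite scalerA.
Qed.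

Fact tscale1 : left_id 1 tscale.
Proof.
elim/tensorW=> s; rewrite tscaleE; congr tclass.
by rewrite -[RHS]map_id; apply: eq_map => -[v w] /=; rewrite scale1r.
Qed.

Fact tscaleDr : right_distributive tscale +%R.
Proof.
move=> a; elim/tensorW=> s; elim/tensorW=> t.
by rewrite -tclass_cat !tscaleE map_cat tclass_cat.
Qed.

Fact tscaleDl x : {morph tscale^~ x : a b / a + b}.
Proof.
move=> a b; elim/tensorW: x; elim=> [|[v w] s IH].
  by rewrite !tscaleE tclass_nil addr0.
rewrite -cat1s tclass_cat !tscaleDr IH !tscaleE /= addrACA; congr (_ + _).
by rewrite -tclass_cat scalerDl; apply/tclassP; exact: teq_Dl.
Qed.

HB.instance Definition _ :=
  GRing.Zmodule_isLmodule.Build K tensor tscaleA tscale1 tscaleDr tscaleDl.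

Lemma tclassZ a s : a *: tclass s = tclass [seq (a *: p.1, p.2) | p <- s].
Proof. exact: tscaleE. Qed.

Definition tens v w : tensor := tclass [:: (v, w)].

Lemma tclassE s : tclass s = \sum_(p <- s) tens p.1 p.2.
Proof.
elim: s => [|[v w] s IH]; first by rewrite big_nil.
by rewrite big_cons -IH -cat1s tclass_cat.
Qed.

Lemma tensor_sum z : exists s, z = \sum_(p <- s) tens p.1 p.2.
Proof. by exists (trepr z); rewrite -tclassE treprK. Qed.

Fact tens_is_bilinear : bilinear_for *:%R *:%R tens.
Proof.
split=> [w a v v'|v a w w']; rewrite /tens /=.
- rewrite tclassZ -tclass_cat.
  by apply/tclassP; exact: teq_Dl.
- rewrite tclassZ -tclass_cat; apply/tclassP.
  apply: teq_trans (teq_Dr _ _ _) _; rewrite -cat1s -(cat1s (_, w')).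
  by apply: teq_cat; [apply: teq_sym; exact: teq_Z | exact: teq_refl].
Qed.

HB.instance Definition _ :=
  bilinear_isBilinear.Build K V W tensor *:%R *:%R tens tens_is_bilinear.

Section Lift.
Variables (U : lmodType K) (b : {bilinear V -> W -> U}).

Definition tlift (z : tensor) : U := \sum_(p <- trepr z) b p.1 p.2.

Lemma tensor_eq_sum s t : tensor_eq s t ->
  \sum_(p <- s) b p.1 p.2 = \sum_(p <- t) b p.1 p.2.
Proof.
elim=> {s t} //=.
- by move=> s t u _ -> _ ->.
- by move=> s s' t t' _ h _ h'; rewrite !big_cat /= h h'.
- by move=> s t; rewrite !big_cat /= addrC.
- by move=> v v' w; rewrite !big_cons !big_nil /= linearDl /= !addr0.
- by move=> v w w'; rewrite !big_cons !big_nil /= linearDr /= !addr0.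
- by move=> a v w; rewrite !big_cons !big_nil /= linearZl_LR linearZr_LR.
- by move=> w; rewrite big_cons big_nil /= linear0l addr0.
Qed.

Lemma tlift_class s : tlift (tclass s) = \sum_(p <- s) b p.1 p.2.
Proof. by apply: tensor_eq_sum; exact: trepr_eq. Qed.

Lemma tliftE v w : tlift (tens v w) = b v w.
Proof. by rewrite tlift_class big_seq1. Qed.

Fact tlift_is_linear : linear tlift.
Proof.
move=> a; elim/tensorW=> s; elim/tensorW=> t.
rewrite tclassZ -tclass_cat !tlift_class big_cat big_map scaler_sumr.
by congr (_ + _); apply: eq_bigr => p _ /=; rewrite linearZl_LR.
Qed.

HB.instance Definition _ :=
  GRing.isLinear.Build K tensor U *:%R tlift tlift_is_linear.

Lemma tlift_uniq (h : {linear tensor -> U}) :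
  (forall v w, h (tens v w) = b v w) -> h =1 tlift.
Proof.
move=> hE z; have [s ->] := tensor_sum z.
by rewrite !linear_sum; apply: eq_bigr => p _; rewrite hE [RHS]tliftE.
Qed.

End Lift.
End Tensor.

Notation "v *t w" := (tens v w) (at level 40, left associativity) : ring_scope.

Section TensorMap.
Variables (K : comNzRingType) (V V' W W' : lmodType K).
Variables (f : {linear V -> V'}) (g : {linear W -> W'}).

Definition tens_map2 (v : V) (w : W) : tensor V' W' := f v *t g w.

Fact tens_map2_is_bilinear : bilinear_for *:%R *:%R tens_map2.
Proof.
split=> [w a v v'|v a w w']; rewrite /tens_map2 /= !linearP.
- by rewrite linearPl.
- by rewrite linearPr.
Qed.

HB.instance Definition _ := bilinear_isBilinear.Build K V W (tensor V' W')
  *:%R *:%R tens_map2 tens_map2_is_bilinear.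

Definition tensor_map : {linear tensor V W -> tensor V' W'} := tlift tens_map2.

Lemma tensor_mapE v w : tensor_map (v *t w) = f v *t g w.
Proof. exact: tliftE. Qed.

End TensorMap.

Section TensorFunctional.
Variables (K : comNzRingType) (V W : lmodType K).
Variables (f : {linear V -> K^o}) (g : {linear W -> K^o}).

Definition mul_fun2 (v : V) (w : W) : K^o := f v * g w.

Fact mul_fun2_is_bilinear : bilinear_for *:%R *:%R mul_fun2.
Proof.
split=> [w a v v'|v a w w']; rewrite /mul_fun2 /= linearP.
- by rewrite mulrDl -scalerAl.
- by rewrite mulrDr -scalerAr.
Qed.

HB.instance Definition _ := bilinear_isBilinear.Build K V W K^o
  *:%R *:%R mul_fun2 mul_fun2_is_bilinear.

Definition tensor_fun : {linear tensor V W -> K^o} := tlift mul_fun2.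

Lemma tensor_funE v w : tensor_fun (v *t w) = f v * g w.
Proof. exact: tliftE. Qed.

End TensorFunctional.

HB.mixin Record isFunctionSystem (R : realType) V of GRing.Lmodule R V := {
  poscone : set V;
  ounit : V;
  poscone0 : poscone 0;
  posconeD : forall v w, poscone v -> poscone w -> poscone (v + w);
  posconeZ : forall (a : R) v, 0 <= a -> poscone v -> poscone (a *: v);
  poscone_proper : forall v, poscone v -> poscone (- v) -> v = 0;
  ounit_order : forall v, exists2 r : R, 0 < r & poscone (r *: ounit - v);
  ounit_archimedean : forall v,
    (forall e : R, 0 < e -> poscone (e *: ounit + v)) -> poscone v
}.

#[short(type="functionSystemType")]
HB.structure Definition FunctionSystem (R : realType) :=
  {V of isFunctionSystem R V & GRing.Lmodule R V}.

Arguments poscone {R V} : rename.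
Arguments ounit {R V} : rename.

Section FunctionSystemTheory.
Variable R : realType.
Implicit Types V W : functionSystemType R.

Definition fs_le V (v w : V) : Prop := poscone (w - v).

Definition order_norm V (v : V) : R :=
  inf [set r : R | [/\ 0 < r, fs_le (- (r *: ounit)) v & fs_le v (r *: ounit)]].

Definition unital_positive V W (f : {linear V -> W}) : Prop :=
  (forall v, poscone v -> poscone (f v)) /\ f ounit = ounit.

Definition is_state V (f : {linear V -> R^o}) : Prop :=
  (forall v, poscone v -> 0 <= f v) /\ f ounit = 1.

Definition min_cone V W : set (tensor V W) :=
  [set z | forall (f : {linear V -> R^o}) (g : {linear W -> R^o}),
    is_state f -> is_state g -> 0 <= tensor_fun f g z].

Definition alg_cone V W : set (tensor V W) :=
  [set z | exists2 s : seq (V * W),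
    (forall p, p \in s -> poscone p.1 /\ poscone p.2) &
    z = \sum_(p <- s) p.1 *t p.2].

Definition max_cone V W : set (tensor V W) :=
  [set z | forall e : R, 0 < e -> @alg_cone V W (z + e *: (ounit *t ounit))].

(* Positivity of id_A (x) Phi : A (x)_min V -> A (x)_max W depends only on the
   two positive cones, so the minimal and maximal tensor products are given by
   min_cone and max_cone on the same underlying space. *)
Definition min_max_positive V W (A : functionSystemType R)
    (Phi : {linear V -> W}) : Prop :=
  forall z : tensor A V, min_cone z -> max_cone (tensor_map (@idfun A) Phi z).

End FunctionSystemTheory.

Definition finite_dimensional (K : nzRingType) (E : lmodType K) : Prop :=
  exists n (b : 'I_n -> E), forall v, exists c : 'I_n -> K,
    v = \sum_i c i *: b i.

Definition linf (R : realType) (n : nat) : Type := 'rV[R]_n.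

Section Linf.
Variables (R : realType) (n : nat).
HB.instance Definition _ := GRing.Lmodule.copy (linf R n) 'rV[R]_n.

Definition linf_pos : set (linf R n) :=
  [set x | forall i, 0 <= (x : 'rV[R]_n) 0 i].
Definition linf_unit : linf R n := (const_mx 1 : 'rV[R]_n).

Fact linf_pos0 : linf_pos 0.
Proof. by move=> i; rewrite mxE. Qed.

Fact linf_posD v w : linf_pos v -> linf_pos w -> linf_pos (v + w).
Proof. by move=> hv hw i; rewrite mxE addr_ge0. Qed.

Fact linf_posZ (a : R) v : 0 <= a -> linf_pos v -> linf_pos (a *: v).
Proof. by move=> a0 hv i; rewrite mxE mulr_ge0. Qed.

Fact linf_proper v : linf_pos v -> linf_pos (- v) -> v = 0.
Proof.
move=> hv hNv; apply/rowP => i; rewrite mxE; apply/eqP.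
by rewrite eq_le hv andbT; have := hNv i; rewrite mxE oppr_ge0.
Qed.

Fact linf_order v : exists2 r : R, 0 < r & linf_pos (r *: linf_unit - v).
Proof.
exists (1 + \sum_i `|(v : 'rV[R]_n) 0 i|).
  by rewrite ltr_wpDr // sumr_ge0.
move=> i; rewrite !mxE mulr1 subr_ge0 (le_trans (ler_norm _)) //.
by rewrite (bigD1 i) //= addrCA lerDl addr_ge0 // sumr_ge0.
Qed.

Fact linf_archimedean v :
  (forall e : R, 0 < e -> linf_pos (e *: linf_unit + v)) -> linf_pos v.
Proof.
move=> h i; apply/ler_addgt0Pr => e e0.
by have := h e e0 i; rewrite !mxE mulr1 addrC.
Qed.

HB.instance Definition _ := isFunctionSystem.Build R (linf R n)
  linf_pos0 linf_posD linf_posZ linf_proper linf_order linf_archimedean.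
End Linf.

Definition directed_preorder (I : Type) (le : I -> I -> Prop) : Prop :=
  [/\ inhabited I, forall i, le i i,
      forall i j k, le i j -> le j k -> le i k
    & forall i j, exists k, le i k /\ le j k].

Definition net_to0 (R : realType) (I : Type) (le : I -> I -> Prop)
    (u : I -> R) : Prop :=
  forall e : R, 0 < e -> exists i0, forall i, le i0 i -> `|u i| < e.

(* Main.v *)
(* (iii) => (i): through l^oo_n, a min-positive z becomes a sum of b_i (x) psi(e_i)
   with b_i positive, because all states are nonnegative on b_i; the remaining
   error is a tensor with small second factors, absorbed by any multiple of the
   order unit.

   (ii) => (iii): given finitely many vectors of V, choose states f_i and vectors
   u_i with f_i(u_j) = delta_ij such that the span F of the u_i contains them and
   the order unit.  The dual of F, with order unit the sum of the f_i, is a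
   finite-dimensional function system, and the element of F* (x) V given by the
   inclusion of F in V is min-positive.  Its image in F* (x) W being max-positive,
   Phi + e (sum_i f_i) e_W agrees on F with a sum of h_k(.) w_k where w_k >= 0 and
   h_k is positive on F.  Extending the h_k to V (M. Riesz) and normalizing them
   to states gives the factorization through l^oo_m. *)
From HB Require Import structures.
Require Import Defs.
From mathcomp Require Import all_boot all_order all_algebra.
From mathcomp Require Import sesquilinear.
From mathcomp Require Import all_classical all_reals.

Set Implicit Arguments.
Unset Strict Implicit.
Unset Printing Implicit Defensive.

Import Order.TTheory GRing.Theory Num.Theory.
Local Open Scope classical_set_scope.
Local Open Scope ring_scope.

(** * Extension of positive functionals and separation by states *)

Section Extension.
Variables (R : realType) (V : functionSystemType R).
Implicit Types (G M : set (V * R^o)) (v x y : V) (r s t : R).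

(* The graph of a positive functional on a subspace.  Single-valuedness is
   positivity at 0. *)
Definition positive_relation G : Prop :=
  (forall t p q, G p -> G q -> G (t *: p + q)) /\
  (forall p, G p -> poscone p.1 -> 0 <= p.2).

(** The new vector [v] receives the least value that positivity allows, the supremum of the values
    of [G] at elements below [v]. The second clause records this minimality, on which [separation]
    relies. *)
Lemma positive_relation_step G v (c : R) :
  positive_relation G -> G (ounit, c) ->
  exists2 r : R,
    positive_relation
      [set p : V * R^o |
        exists2 q, G q & exists t, p = t *: ((v, r) : V * R^o) + q]
    & forall b, (forall x s, G (x, s) -> poscone (v - x) -> s <= b) -> r <= b.
Proof.
move=> [Glin Gpos] Ge.
have G0 : G 0 by rewrite -(addNr (ounit, c : R^o)) -scaleN1r; exact: Glin.
have GZ t p : G p -> G (t *: p).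
  by move=> Gp; rewrite -[_ *: _]addr0; exact: Glin.
have GB p q : G p -> G q -> G (p - q).
  by move=> Gp Gq; rewrite addrC -scaleN1r; exact: Glin.
pose S := [set s : R | exists2 x, G (x, s) & poscone (v - x)].
have S_sup : has_sup S.
  split.
    have [r _ hr] := ounit_order (- v); exists (- r * c), (- r *: ounit).
      exact: (GZ _ _ Ge).
    by rewrite scaleNr opprK addrC -[v]opprK.
  have [r _ hr] := ounit_order v; exists (r * c) => s [x Gx hx].
  rewrite -subr_ge0; apply: (Gpos (r *: ounit - x, r * c - s : R^o)) => /=.
    exact: GB (GZ r _ Ge) Gx.
  by have := posconeD _ _ hr hx; rewrite addrA subrK.
exists (sup S); last first.
  by move=> b hb; apply: ge_sup; [case: S_sup | move=> s [x Gx]; exact: hb].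
split.
  move=> t p q [p' Gp' [a ->]] [q' Gq' [b ->]].
  exists (t *: p' + q'); first exact: Glin.
  by exists (t * a + b); rewrite scalerDl scalerDr -scalerA addrACA.
(* If t > 0, positivity of t v + x means -x/t <= v, so -s/t lies in [S]; if t < 0, it means v <=
   -x/t, so -s/t is an upper bound of [S]. *)
move=> _ [[x s] Gx [t ->]] /=; have [t0|t0|->] := ltgtP t 0; last first.
- by rewrite !scale0r !add0r => /(Gpos _ Gx).
- move=> h; rewrite -[_ *: _]/(t * sup S) -[s]opprK subr_ge0 mulrC -ler_pdivrMr //.
  apply: ub_le_sup; first by case: S_sup.
  exists (- t^-1 *: x).
    by rewrite mulrC mulrN -mulNr; exact: GZ (- t^-1) _ Gx.
  have := posconeZ t^-1 _ _ h; rewrite invr_ge0 ltW // => /(_ isT).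
  by rewrite scalerDr scalerA mulVf ?gt_eqF // scale1r scaleNr opprK.
- move=> h; have t0' : 0 < - t by rewrite oppr_gt0.
  rewrite -[_ *: _]/(t * sup S) -[t]opprK mulNr addrC subr_ge0 mulrC
    -ler_pdivlMr //.
  apply: ge_sup; first by case: S_sup.
  move=> s' [y Gy hy]; rewrite -subr_ge0.
  have /Gpos /= := GB _ _ (GZ (- t)^-1 _ Gx) Gy.
  rewrite -[_ *: s]/(_ * s) mulrC; apply.
  have := posconeZ (- t)^-1 _ _ h; rewrite invr_ge0 ltW // => /(_ isT).
  rewrite scalerDr scalerA -[X in _ * X]opprK mulrN mulVf ?gt_eqF //
    scaleN1r => h'.
  by have := posconeD _ _ h' hy; rewrite addrA (addrC (- v)) subrK.
Qed.

Theorem riesz_extension G (c : R) :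
  positive_relation G -> G (ounit, c) ->
  exists f : {linear V -> R^o},
    (forall v, poscone v -> 0 <= f v) /\ (forall p, G p -> f p.1 = p.2).
Proof.
move=> Gok Ge.
(* Extending [G] is encoded by the union with [G]: a condition that [M] contain [G] would fail for
   the union of the empty chain. *)
have [|M [Mok Mmax]] := @Zorn_bigcup _ [set M | positive_relation (M `|` G)].
  move=> F FP Ftot; split.
    move=> t p q [[X FX Xp]|Gp] [[Y FY Yq]|Gq].
    - have [XY|YX] := Ftot _ _ FX FY.
      + have [+ _] := FP _ FY => /(_ t p q (or_introl (XY _ Xp))
          (or_introl Yq)).
        by move=> [?|?]; [left; exists Y|right].
      + have [+ _] := FP _ FX => /(_ t p q (or_introl Xp)
          (or_introl (YX _ Yq))).
        by move=> [?|?]; [left; exists X|right].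
    - have [+ _] := FP _ FX => /(_ t p q (or_introl Xp) (or_intror Gq)).
      by move=> [?|?]; [left; exists X|right].
    - have [+ _] := FP _ FY => /(_ t p q (or_intror Gp) (or_introl Yq)).
      by move=> [?|?]; [left; exists Y|right].
    - by right; apply: Gok.1.
  move=> p [[X FX Xp]|Gp]; last exact: Gok.2.
  by have [_] := FP _ FX; apply; left.
have [Mlin Mpos] := Mok.
have Me : (M `|` G) (ounit, c) by right.
have M0 : (M `|` G) 0.
  by rewrite -(addNr (ounit, c : R^o)) -scaleN1r; exact: Mlin.
(* Otherwise the one-step extension to [v] would properly contain the maximal [M]. *)
have dom v : exists r : R, (M `|` G) (v, r).
  have [r Bok _] := positive_relation_step v Mok Me; exists r; left.
  set B := (X in positive_relation X) in Bok.
  have MGB : M `|` G `<=` B.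
    by move=> p hp; exists p => //; exists 0; rewrite scale0r add0r.
  apply: contrapT => Mv; apply: (Mmax B).
    split; first by move=> p Mp; apply: MGB; left.
    by move=> /(_ (v, r)) h; apply/Mv/h; exists 0 => //; exists 1;
      rewrite scale1r addr0.
  rewrite /mkset; have -> : B `|` G = B.
    by apply/setUidPl => p Gp; apply: MGB; right.
  exact: Bok.
have funct v (r s : R^o) : (M `|` G) (v, r) -> (M `|` G) (v, s) -> r = s.
  move=> hr hs.
  have ge r' s' : (M `|` G) (v, r') -> (M `|` G) (v, s') -> r' <= s'.
    move=> hr' hs'; rewrite -subr_ge0 addrC.
    have /Mpos /= := Mlin (-1) _ _ hr' hs'.
    by rewrite !scaleN1r addNr; apply; exact: poscone0.
  by apply/eqP; rewrite eq_le !ge.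
pose f v : R^o := projT1 (cid (dom v)).
have fP v : (M `|` G) (v, f v) by rewrite /f; case: cid.
have flin : linear f.
  by move=> t x y; apply: funct (fP _) _; exact: (Mlin t _ _ (fP x) (fP y)).
pose fL := GRing.isLinear.Build R V R^o *:%R f flin.
pose F : {linear V -> R^o} := HB.pack f fL.
exists F; split; first by move=> v; exact: Mpos (fP v).
by move=> [v r] Gp /=; apply: funct (fP v) _; right.
Qed.

Lemma poscone_ounit : poscone (ounit : V).
Proof.
have [r r0] := ounit_order (0 : V); rewrite subr0 => /(posconeZ r^-1).
by rewrite scalerA mulVf ?gt_eqF // scale1r invr_ge0 ltW //; exact.
Qed.

(** On the line of the order unit put f(t e) = t, and give [a] the least admissible value, the
    supremum of the s with s e <= a. As [a] is not positive, the Archimedean property bounds this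
    supremum by a negative number. *)
Corollary separation (a : V) : ~ poscone a ->
  exists2 f : {linear V -> R^o}, is_state f & f a < 0.
Proof.
move=> Na; pose G := [set p : V * R^o | p.1 = p.2 *: ounit].
(* If t times the order unit were positive with t < 0, the order unit would be 0 and every vector
   positive, [a] included. *)
have unit_scale (t : R) : poscone (t *: ounit : V) -> 0 <= t.
  move=> ht; case: leP => // t0; exfalso; apply: Na.
  have e0 : ounit = 0 :> V.
    apply: poscone_proper; first exact: poscone_ounit.
    have := posconeZ (- t)^-1 _ _ ht; rewrite invr_ge0 oppr_ge0 ltW // =>
      /(_ isT).
    by rewrite scalerA invrN mulNr mulVf ?lt_eqF // scaleNr scale1r.
  by have [r _] := ounit_order (- a); rewrite e0 scaler0 add0r opprK.
have Gok : positive_relation G.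
  rewrite /G; split=> [t p q /= -> ->|p /= ->]; last exact: unit_scale.
  by rewrite scalerA -scalerDl.
have Ge : G (ounit, 1) by rewrite /G /= scale1r.
have [r Bok rmin] := positive_relation_step a Gok Ge.
have [f [fpos fG]] : exists f : {linear V -> R^o},
    (forall v, poscone v -> 0 <= f v) /\
    (forall p, (exists2 q, G q & exists t, p = t *: ((a, r) : V * R^o) + q) ->
      f p.1 = p.2).
  apply: riesz_extension Bok _ => /=.
  by exists (ounit, 1) => //; exists 0; rewrite scale0r add0r.
exists f; first split=> //.
  by apply: (fG (ounit, 1)); exists (ounit, 1) => //; exists 0;
    rewrite scale0r add0r.
have [e e0 he] : exists2 e : R, 0 < e & ~ poscone (e *: ounit + a).
  apply: contrapT => h; apply/Na/ounit_archimedean => e e0.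
  by apply: contrapT => he; apply: h; exists e.
have -> : f a = r.
  apply: (fG (a, r)); exists 0; first by rewrite /G /= scale0r.
  by exists 1; rewrite scale1r addr0.
suff : r <= - e by move/le_lt_trans; apply; rewrite oppr_lt0.
apply: rmin => x s; rewrite /G /= => -> h; rewrite leNgt; apply/negP => es.
apply: he; have se : 0 <= s + e by rewrite -(opprK e) subr_ge0 ltW.
have := posconeD _ _ (posconeZ _ _ se poscone_ounit) h.
by rewrite scalerDl addrC addrA subrK addrC.
Qed.

End Extension.

(** * Order norm and bounds by the order unit *)

Section OrderNorm.
Variables (R : realType) (V : functionSystemType R).
Implicit Types (v : V) (d : R).

Lemma two_sided_bound v :
  exists2 r : R, 0 < r & poscone (r *: ounit + v) /\ poscone (r *: ounit - v).
Proof.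
have [r r0 hr] := ounit_order v; have [s s0 hs] := ounit_order (- v).
rewrite opprK in hs; exists (r + s); first exact: addr_gt0.
split; rewrite scalerDl.
  by rewrite -addrA; apply: posconeD hs; apply: posconeZ (ltW r0)
    (poscone_ounit V).
by rewrite addrAC; apply: posconeD hr _; apply: posconeZ (ltW s0)
  (poscone_ounit V).
Qed.

Lemma order_norm_lt v d : order_norm v < d ->
  poscone (d *: ounit + v) /\ poscone (d *: ounit - v).
Proof.
move=> /inf_lt[|r [r0]].
  have [r r0 [hl hr]] := two_sided_bound v; exists r; split=> //.
  by rewrite /fs_le opprK addrC.
rewrite /fs_le opprK => hl hr rd.
have h : poscone ((d - r) *: ounit : V).
  by apply: posconeZ (poscone_ounit V); rewrite subr_ge0 ltW.
rewrite -(subrK r d) scalerDl -!addrA; split; apply: posconeD => //.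
by rewrite addrC.
Qed.

Lemma order_norm_le v d : 0 < d ->
  poscone (d *: ounit + v) -> poscone (d *: ounit - v) -> `|order_norm v| <= d.
Proof.
move=> d0 hl hr; rewrite ger0_norm.
  apply: ge_inf; first by exists 0 => r [/ltW].
  by split=> //; rewrite /fs_le opprK addrC.
by apply: lb_le_inf => [|r [/ltW//]]; exists d; split=> //;
  rewrite /fs_le opprK addrC.
Qed.

End OrderNorm.

(** * The cone of sums of positive elementary tensors *)

Section AlgCone.
Variables (R : realType) (V W : functionSystemType R).
Implicit Types (x y : tensor V W).

Lemma alg_cone0 : alg_cone (0 : tensor V W).
Proof. by exists [::] => //; rewrite big_nil. Qed.

Lemma alg_coneD x y : alg_cone x -> alg_cone y -> alg_cone (x + y).
Proof.
move=> [s hs ->] [t ht ->]; exists (s ++ t); last by rewrite big_cat.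
by move=> p; rewrite mem_cat => /orP[/hs|/ht].
Qed.

Lemma alg_cone_tens (v : V) (w : W) :
  poscone v -> poscone w -> alg_cone (v *t w).
Proof.
move=> hv hw; exists [:: (v, w)]; last by rewrite big_seq1.
by move=> p; rewrite inE => /eqP ->.
Qed.

Lemma alg_coneZ (a : R) x : 0 <= a -> alg_cone x -> alg_cone (a *: x).
Proof.
move=> a0 [s hs ->]; exists [seq (a *: p.1, p.2) | p <- s].
  by move=> _ /mapP[p /hs[h1 h2] ->]; split=> //; exact: posconeZ.
by rewrite big_map scaler_sumr; apply: eq_bigr => p _ /=; rewrite linearZl_LR.
Qed.

Lemma alg_cone_sum n (F : 'I_n -> tensor V W) :
  (forall i, alg_cone (F i)) -> alg_cone (\sum_i F i).
Proof.
by move=> h; elim/big_ind: _ => //; [exact: alg_cone0 | exact: alg_coneD].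
Qed.

(* 2 (v (x) w + r d e (x) e) =
   (r e + v) (x) (d e + w) + (r e - v) (x) (d e - w) *)
Lemma alg_cone_perturb (v : V) (w : W) (r d : R) :
  poscone (r *: ounit + v) -> poscone (r *: ounit - v) ->
  poscone (d *: ounit + w) -> poscone (d *: ounit - w) ->
  alg_cone (v *t w + (r * d) *: (ounit *t ounit)).
Proof.
move=> v1 v2 w1 w2.
have := alg_coneD (alg_cone_tens v1 w1) (alg_cone_tens v2 w2).
move/(alg_coneZ (a := 2^-1)); rewrite invr_ge0 ler0n => /(_ isT);
  congr alg_cone.
rewrite !(linearDl, linearDr, linearNl, linearNr, linearZl_LR, linearZr_LR) /=.
rewrite opprK scalerA; set e := _ *: (_ *t _); set a := r *: _; set b := d *: _.
rewrite addrACA (addrACA e a) subrr addr0 (addrACA b) subrr add0r.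
by rewrite -!mulr2n -mulrnDl -scaler_nat scalerA mulVf ?pnatr_eq0 //
  scale1r addrC.
Qed.

(** The constant [C] depends only on the first factors, so it is fixed before the perturbation [h]
    and its size [d] are chosen. *)
Lemma alg_cone_perturb_sum (T : eqType) (s : seq (V * T)) :
  exists2 C : R, 0 < C &
  forall (d : R) (h : T -> W), 0 <= d ->
    (forall x : T, x \in unzip2 s ->
      poscone (d *: ounit + h x) /\ poscone (d *: ounit - h x)) ->
    alg_cone (\sum_(p <- s) p.1 *t h p.2 + (C * d) *: (ounit *t ounit)).
Proof.
elim: s => [|[v w] s [C C0 IH]].
  exists 1 => // d h d0 _; rewrite big_nil add0r mul1r; apply: alg_coneZ d0 _.
  by apply: alg_cone_tens; exact: poscone_ounit.
have [r r0 [v1 v2]] := two_sided_bound v.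
exists (r + C); first exact: addr_gt0.
move=> d h d0 hs; rewrite big_cons /= mulrDl scalerDl addrACA; apply: alg_coneD.
  have [w1 w2] := hs w (mem_head _ _).
  exact: alg_cone_perturb.
by apply: IH => // x xs; apply: hs; rewrite inE xs orbT.
Qed.

End AlgCone.

(** * From approximate factorizations to positivity from min to max *)

Section Factorization.
Variables (R : realType) (A V W : functionSystemType R) (n : nat).
Variables (phi : {linear V -> linf R n}) (psi : {linear linf R n -> W}).
Hypotheses (hphi : unital_positive phi) (hpsi : unital_positive psi).

Definition coord_fun (i : 'I_n) (v : V) : R^o := (phi v : 'rV[R]_n) 0 i.

Fact coord_fun_is_linear i : linear (coord_fun i).
Proof. by move=> a v v'; rewrite /coord_fun linearP !mxE. Qed.

HB.instance Definition _ i :=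
  GRing.isLinear.Build R V R^o *:%R (coord_fun i) (coord_fun_is_linear i).

Lemma coord_fun_state i : is_state (coord_fun i).
Proof.
split=> [v /hphi.1|]; first exact.
by rewrite /= /coord_fun hphi.2 mxE.
Qed.

Lemma linf_decomp (x : linf R n) :
  x = \sum_i (x : 'rV[R]_n) 0 i *: (delta_mx 0 i : linf R n).
Proof. exact: row_sum_delta. Qed.

Lemma alg_cone_factor (s : seq (A * V)) :
  min_cone (\sum_(p <- s) p.1 *t p.2) ->
  alg_cone (\sum_(p <- s) p.1 *t psi (phi p.2)).
Proof.
move=> smin.
(* [b i] is a slice of the tensor z: a state f takes on it the value of f (x) [coord_fun i] at z,
   which is nonnegative, so [separation] makes [b i] positive. *)
pose b i : A := \sum_(p <- s) coord_fun i p.2 *: p.1.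
have -> : \sum_(p <- s) p.1 *t psi (phi p.2) =
    \sum_i b i *t psi (delta_mx 0 i).
  under [RHS]eq_bigr do rewrite linear_sumlz.
  rewrite exchange_big /=; apply: eq_bigr => p _.
  rewrite {1}(linf_decomp (phi p.2)) linear_sum linear_sumr.
  by apply: eq_bigr => i _; rewrite linearZ linearZr_LR linearZl_LR.
apply: alg_cone_sum => i; apply: alg_cone_tens; last first.
  by apply: hpsi.1 => j; rewrite mxE; case: (_ && _); rewrite ?ler0n.
apply: contrapT => /separation[f fstate]; rewrite ltNge => /negP; apply.
have := smin f (coord_fun i) fstate (coord_fun_state i).
rewrite !linear_sum; apply: etrans; congr (_ <= _).
by apply: eq_bigr => p _; rewrite tensor_funE linearZ /= mulrC.
Qed.

End Factorization.

Lemma net_to0_seq (R : realType) (I : Type) (T : eqType) (le : I -> I -> Prop)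
    (u : T -> I -> R) (s : seq T) (d : R) :
  directed_preorder le -> (forall x, net_to0 le (u x)) -> 0 < d ->
  exists i0, forall i, le i0 i -> forall x, x \in s -> `|u x i| < d.
Proof.
move=> [[i0] _ letr ledir] hu d0; elim: s => [|x s [i1 h1]].
  by exists i0.
have [i2 h2] := hu x d d0; have [k [k1 k2]] := ledir i1 i2.
exists k => i ki y; rewrite inE => /orP[/eqP->|]; first by apply: h2;
  exact: letr k2 ki.
by apply: h1; exact: letr k1 ki.
Qed.

(** The image of z is the factored part, which lies in the algebraic cone, plus an error whose
    second factors [Phi v - psi i (phi i v)] tend to 0. *)
Theorem factorization_min_max (R : realType) (A V W : functionSystemType R)
    (Phi : {linear V -> W}) (I : Type) (le : I -> I -> Prop) (n : I -> nat)
    (phi : forall i, {linear V -> linf R (n i)})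
    (psi : forall i, {linear linf R (n i) -> W}) :
  directed_preorder le ->
  (forall i, unital_positive (phi i)) -> (forall i, unital_positive (psi i)) ->
  (forall v : V, net_to0 le (fun i => order_norm (psi i (phi i v) - Phi v))) ->
  min_max_positive A Phi.
Proof.
move=> dir hphi hpsi conv z; have [s ->] := tensor_sum z => smin e e0.
rewrite linear_sum; under eq_bigr do rewrite tensor_mapE /=.
have [C C0 hC] := alg_cone_perturb_sum W s.
(* With second factors smaller than e / C, the error is absorbed by C (e / C) = e times the unit. *)
have eC : 0 < e / C by exact: divr_gt0.
have [i hi] := net_to0_seq (unzip2 s) dir conv eC.
have [_ lexx _ _] := dir.
have := hC (e / C) (fun v => Phi v - psi i (phi i v)) (ltW eC).
rewrite mulrCA divff ?gt_eqF // mulr1 => /(_ _)/wrap[v vs|h].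
  have := order_norm_lt (le_lt_trans (ler_norm _) (hi i (lexx i) v vs)).
  by rewrite opprB => -[h1 h2]; split; rewrite // opprB.
have := alg_coneD (alg_cone_factor (hphi i) (hpsi i) smin) h.
rewrite addrA -big_split /=; congr alg_cone; congr (_ + _).
by apply: eq_bigr => p _; rewrite -linearDr addrC subrK.
Qed.

(** * Biorthogonal families of vectors and states *)

Definition ord_cons T n (x : T) (f : 'I_n -> T) (i : 'I_n.+1) : T :=
  if unlift ord0 i is Some j then f j else x.

Lemma ord_cons0 T n (x : T) (f : 'I_n -> T) : ord_cons x f ord0 = x.
Proof. by rewrite /ord_cons unlift_none. Qed.

Lemma ord_consS T n (x : T) (f : 'I_n -> T) i :
  ord_cons x f (lift ord0 i) = f i.
Proof. by rewrite /ord_cons liftK. Qed.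

Definition ord_consE := (ord_cons0, ord_consS).

Section Biorthogonal.
Variables (R : realType) (V : functionSystemType R).

Lemma linear_funZ (f : {linear V -> R^o}) (a : R) v : f (a *: v) = a * f v.
Proof. exact: linearZ. Qed.

(** A nonzero vector and its negative cannot both be positive, so some state is negative on one of
    them. *)
Lemma state_neq0 (v : V) : v != 0 ->
  exists2 f : {linear V -> R^o}, is_state f & f v != 0.
Proof.
move=> v0; have [pv|/separation[f fs fv]] := pselect (poscone v); last first.
  by exists f => //; rewrite lt_eqF.
have [pNv|/separation[f fs fv]] := pselect (poscone (- v)).
  by rewrite (poscone_proper _ pv pNv) eqxx in v0.
by exists f => //; move: fv; rewrite linearN oppr_lt0 => /gt_eqF->.
Qed.

Definition biorthogonal n (f : 'I_n -> {linear V -> R^o}) (u : 'I_n -> V) :=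
  forall i j, f i (u j) = (i == j)%:R.

(** For biorthogonal families this says that [v] lies in the span of the [u i], with the [f i] as
    coordinate functionals. *)
Definition expands n (f : 'I_n -> {linear V -> R^o}) (u : 'I_n -> V) (v : V) :=
  v = \sum_i f i v *: u i.

Lemma expandsP n (f : 'I_n -> {linear V -> R^o}) (u : 'I_n -> V) (a : R) x y :
  expands f u x -> expands f u y -> expands f u (a *: x + y).
Proof.
move=> ex ey; rewrite /expands {1}ex {1}ey scaler_sumr -big_split /=.
by apply: eq_bigr => i _; rewrite linearP scalerDl scalerA.
Qed.

Lemma expands0 n (f : 'I_n -> {linear V -> R^o}) (u : 'I_n -> V) :
  expands f u 0.
Proof. by rewrite /expands big1 // => i _; rewrite linear0 scale0r. Qed.

(** A Gram-Schmidt induction. The part w of a new vector that the old family misses is killed by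
    every [f i]; a state g with nonzero g(w) joins the functionals and w / g(w) joins the vectors.
    Only the old vectors are corrected, to make g vanish on them, so the old functionals remain
    states. *)
Lemma biorthogonal_system (s : seq V) :
  exists n (f : 'I_n -> {linear V -> R^o}) (u : 'I_n -> V),
    [/\ forall i, is_state (f i), biorthogonal f u &
        forall v, v \in s -> expands f u v].
Proof.
elim: s => [|v s [n [f [u [fs fu us]]]]].
  by exists 0%N, (fun=> \0), (fun=> 0); split=> // -[].
pose w := v - \sum_i f i v *: u i.
have [w0|/state_neq0[g gs gw]] := eqVneq w 0.
  exists n, f, u; split=> // x; rewrite inE => /orP[/eqP->|]; last exact: us.
  by apply/eqP; rewrite -subr_eq0; apply/eqP.
have fw i : f i w = 0.
  rewrite linearB linear_sum (bigD1 i) //= linear_funZ fu eqxx mulr1 big1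
    ?addr0 ?subrr // => j ji.
  by rewrite linear_funZ fu eq_sym (negbTE ji) mulr0.
pose u0 := (g w)^-1 *: w; pose u' := ord_cons u0 (fun j => u j - g (u j) *: u0).
have gu0 : g u0 = 1 by rewrite linear_funZ mulVf.
have fu0 i : f i u0 = 0 by rewrite linear_funZ fw mulr0.
(* The corrections subtract g(x) [u0] in total, which the new first term adds back. *)
have gE x : expands f u x -> expands (ord_cons g f) u' x.
  move=> ex; rewrite /expands big_ord_recl /u' !ord_consE.
  under eq_bigr do rewrite !ord_consE scalerBr scalerA.
  rewrite sumrB -ex -scaler_suml {2}ex linear_sum.
  by under eq_bigr do rewrite linear_funZ; rewrite addrC subrK.
exists n.+1, (ord_cons g f), u'; split.
- by move=> i; case: (unliftP ord0 i) => [j|] ->; rewrite !ord_consE.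
- move=> i j; rewrite /u'; case: (unliftP ord0 i) => [i'|] ->;
    case: (unliftP ord0 j) => [j'|] ->; rewrite !ord_consE //.
  + by rewrite linearB linear_funZ fu0 mulr0 subr0 fu (inj_eq lift_inj).
  + by rewrite linearB linear_funZ gu0 mulr1 subrr.
move=> x; rewrite inE => /orP[/eqP->|/us/gE//].
have ew : expands (ord_cons g f) u' w.
  rewrite /expands big_ord_recl /u' !ord_consE big1 => [|i _].
    by rewrite addr0 scalerA divff // scale1r.
  by rewrite !ord_consE fw scale0r.
have eF : expands (ord_cons g f) u' (\sum_i f i v *: u i).
  apply: gE; rewrite {1}/expands; apply: eq_bigr => i _; congr (_ *: _).
  by apply/eqP; rewrite -subr_eq0 -linearB; apply/eqP/fw.
by have := expandsP 1 ew eF; rewrite scale1r subrK.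
Qed.

End Biorthogonal.

(** * The dual function system of a finite-dimensional span *)

Section DualSystem.
Variables (R : realType) (V : functionSystemType R) (n : nat).
Variables (f : 'I_n -> {linear V -> R^o}) (u : 'I_n -> V).
Hypotheses (f_state : forall i, is_state (f i)) (fu : biorthogonal f u).
Hypothesis e_expands : expands f u ounit.
Implicit Types (c : 'rV[R]_n) (v : V).

Definition pairing v c : R^o := \sum_i c 0 i * f i v.

Fact pairing_is_linear v : linear (pairing v).
Proof.
move=> a c d; rewrite /pairing scaler_sumr -big_split /=.
by apply: eq_bigr => i _; rewrite !mxE mulrDl -mulrA.
Qed.

HB.instance Definition _ v :=
  GRing.isLinear.Build R 'rV[R]_n R^o *:%R (pairing v) (pairing_is_linear v).

(** Exchanging the arguments of [pairing] lets linearity in [v] be declared separately from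
    linearity in [c]. *)
Definition dual_fun c v : R^o := pairing v c.

Fact dual_fun_is_linear c : linear (dual_fun c).
Proof.
move=> a v w; rewrite /dual_fun /pairing scaler_sumr -big_split /=.
by apply: eq_bigr => i _; rewrite linearD linear_funZ mulrDr mulrCA.
Qed.

HB.instance Definition _ c :=
  GRing.isLinear.Build R V R^o *:%R (dual_fun c) (dual_fun_is_linear c).

(** Positivity is tested only on the span; a member need not be positive on the rest of V, whence
    [dual_cone_extension]. *)
Definition dual_cone : set 'rV[R]_n :=
  [set c | forall v, expands f u v -> poscone v -> 0 <= pairing v c].

Lemma expands_u i : expands f u (u i).
Proof.
rewrite /expands (bigD1 i) //= fu eqxx scale1r big1 ?addr0 // => j ji.
by rewrite fu (negbTE ji) scale0r.
Qed.

Fact dual_cone0 : dual_cone 0.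
Proof. by move=> v _ _; rewrite linear0. Qed.

Fact dual_coneD c d : dual_cone c -> dual_cone d -> dual_cone (c + d).
Proof. by move=> hc hd v ev pv; rewrite linearD addr_ge0 ?hc ?hd. Qed.

Fact dual_coneZ (a : R) c : 0 <= a -> dual_cone c -> dual_cone (a *: c).
Proof. by move=> a0 hc v ev pv; rewrite linearZ mulr_ge0 ?hc. Qed.

(** The span contains the order unit e, so each u_j = r e - (r e - u_j) is a difference of positive
    elements of the span. A functional vanishing on those kills every u_j, where its value is
    c_j. *)
Fact dual_cone_proper c : dual_cone c -> dual_cone (- c) -> c = 0.
Proof.
move=> hc hNc.
have h0 v : expands f u v -> poscone v -> dual_fun c v = 0.
  move=> ev pv; apply/eqP; rewrite eq_le [X in _ && X]hc // andbT.
  by rewrite -oppr_ge0 /dual_fun -linearN hNc.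
apply/rowP => j; rewrite mxE.
have [r _ hr] := ounit_order (u j).
have := h0 _ (expandsP r e_expands (expandsP (-1) (expands_u j) (expands0 f
  u))).
rewrite addr0 scaleN1r => /(_ hr); rewrite linearB linear_funZ /=.
rewrite (h0 _ e_expands (poscone_ounit V)) mulr0 sub0r => /eqP.
rewrite oppr_eq0 => /eqP; rewrite /dual_fun /pairing (bigD1 j) //= fu eqxx
  mulr1.
by rewrite big1 ?addr0 // => i ij; rewrite fu (negbTE ij) mulr0.
Qed.

(** Once r exceeds every |c_i|, the difference is a combination of states with nonnegative
    coefficients. *)
Fact dual_ounit c : exists2 r : R, 0 < r & dual_cone (r *: const_mx 1 - c).
Proof.
exists (1 + \sum_i `|c 0 i|); first by rewrite ltr_wpDr // sumr_ge0.
move=> v _ pv; apply: sumr_ge0 => i _; apply: mulr_ge0;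
  last by case: (f_state i) => + _; apply.
rewrite !mxE mulr1 subr_ge0 (le_trans (ler_norm _)) //
  (bigD1 i) //= addrCA lerDl.
by rewrite addr_ge0 // sumr_ge0.
Qed.

Fact dual_archimedean c :
  (forall e : R, 0 < e -> dual_cone (e *: const_mx 1 + c)) -> dual_cone c.
Proof.
move=> h v ev pv; apply/ler_addgt0Pr => e e0.
set k := pairing v (const_mx 1).
have k0 : 0 <= k.
  by apply: sumr_ge0 => i _; rewrite mxE mul1r; case: (f_state i) => + _; apply.
(* The value [k] may be 0, so the tolerance is e / (k + 1) instead of e / k. *)
have k1 : 0 < k + 1 by rewrite ltr_wpDl.
have := h (e / (k + 1)) (divr_gt0 e0 k1) v ev pv.
rewrite [X in 0 <= X -> _](_ : _ = e / (k + 1) * k + pairing v c);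
  last exact: linearP.
rewrite addrC => /le_trans; apply.
by rewrite lerD2l mulrAC -mulrA ger_pMr // ler_pdivrMr // mul1r lerDl.
Qed.

(* The dual of the span of the [u i], in the coordinates given by the [f i].
   Since the [f i] are positive, their sum is an order unit. *)
Definition dual_system : functionSystemType R :=
  HB.pack 'rV[R]_n
    (isFunctionSystem.Build R 'rV[R]_n dual_cone0 dual_coneD dual_coneZ
       dual_cone_proper dual_ounit dual_archimedean).

Lemma dual_posconeE (c : dual_system) : poscone c = dual_cone c.
Proof. by []. Qed.

Lemma dual_ounitE : ounit = const_mx 1 :> dual_system.
Proof. by []. Qed.

Lemma dual_system_finite : finite_dimensional dual_system.
Proof.
exists n, (fun i => (delta_mx 0 i : 'rV[R]_n)) => v.
by exists (fun i => (v : 'rV[R]_n) 0 i); exact: row_sum_delta.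
Qed.

Lemma pairing_delta v i : pairing v (delta_mx 0 i) = f i v.
Proof.
rewrite /pairing (bigD1 i) //= mxE !eqxx mul1r big1 ?addr0 // => j ji.
by rewrite mxE (negbTE ji) andbF mul0r.
Qed.

Lemma pairing_const v : pairing v (const_mx 1) = \sum_i f i v.
Proof. by apply: eq_bigr => i _; rewrite mxE mul1r. Qed.

Definition dual_basis (i : 'I_n) : dual_system := (delta_mx 0 i : 'rV[R]_n).

Definition inclusion : tensor dual_system V := \sum_i dual_basis i *t u i.

(** For positive g on V, the sum of the g(u_i) f_i agrees with g on the span and so lies in the dual
    cone; s (x) g sends [inclusion] to the value of s at this element. *)
Lemma min_cone_inclusion : min_cone inclusion.
Proof.
move=> s g [spos _] [gpos _].
have -> : tensor_fun s g inclusion = s (\sum_i g (u i) *: dual_basis i).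
  rewrite !linear_sum; apply: eq_bigr => i _.
  by rewrite tensor_funE linear_funZ mulrC.
apply: spos; rewrite dual_posconeE => v ev pv.
suff -> : pairing v (\sum_i g (u i) *: dual_basis i : 'rV[R]_n) = g v.
  exact: gpos.
rewrite linear_sum {2}ev linear_sum; apply: eq_bigr => i _.
by rewrite linear_funZ linearZ /= pairing_delta mulrC.
Qed.

Lemma dual_cone_extension (c : 'rV[R]_n) : dual_cone c ->
  exists h : {linear V -> R^o}, (forall v, poscone v -> 0 <= h v) /\
    (forall v, expands f u v -> h v = pairing v c).
Proof.
move=> hc.
have [|h [hpos hG]] := @riesz_extension _ _
    [set p : V * R^o | expands f u p.1 /\ p.2 = dual_fun c p.1]
    (dual_fun c ounit) _ (conj e_expands erefl).
  split=> [t p q [ep p2] [eq q2]|p [ep p2] pp]; last by rewrite p2; exact: hc.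
  by split; [exact: expandsP | rewrite /= p2 q2 linearP].
by exists h; split=> // v ev; exact: (hG (v, _)).
Qed.

Variable W : functionSystemType R.

(** The operator of rank at most one encoded by c (x) w, evaluated at [v]; the lift [contract] thus
    reads any tensor as an operator into W. *)
Definition contract2 v (c : dual_system) (w : W) : W := pairing v c *: w.

Fact contract2_is_bilinear v : bilinear_for *:%R *:%R (contract2 v).
Proof.
split=> [w a c d|c a w w'] /=.
  by rewrite /contract2 [X in X *: w]linearP scalerDl scalerA.
by rewrite /contract2 scalerDr !scalerA mulrC.
Qed.

HB.instance Definition _ v := bilinear_isBilinear.Build R dual_system W W
  *:%R *:%R (contract2 v) (contract2_is_bilinear v).

Definition contract v : {linear tensor dual_system W -> W} :=
  tlift (contract2 v).

Lemma contractE v c w : contract v (c *t w) = pairing v c *: w.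
Proof. exact: tliftE. Qed.

Lemma contract_alg_cone (x : tensor dual_system W) : alg_cone x ->
  exists m (g : 'I_m -> {linear V -> R^o}) (w : 'I_m -> W),
    [/\ forall i, is_state (g i), forall i, poscone (w i) &
        forall v, expands f u v -> contract v x = \sum_i g i v *: w i].
Proof.
move=> [s + {x}->]; elim: s => [_|[c w] s IH hs].
  exists 0%N, (fun=> \0), (fun=> 0); split=> [[]//|[]//|v _].
  by rewrite big_nil linear0 big_ord0.
have [|m [g [ws [gs wpos gw]]]] := IH.
  by move=> p ps; apply: hs; rewrite inE ps orbT.
have [/= hc hw] := hs _ (mem_head _ _).
have [h [hpos hE]] := dual_cone_extension hc.
have he0 : 0 <= h ounit by apply: (hpos ounit) (poscone_ounit V).
(* If [h] vanishes at the order unit, it is zero and its term is dropped; otherwise dividing by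
   [h ounit] gives a state, and the factor moves to [w]. *)
have [he|he] := eqVneq (h ounit) 0.
  exists m, g, ws; split=> // v ev; rewrite big_cons linearD contractE -hE //=
    gw //.
  have hle x : h x <= 0.
    have [r _ /hpos] := ounit_order x.
    by rewrite linearB linear_funZ he mulr0 sub0r oppr_ge0.
  suff -> : h v = 0 by rewrite scale0r add0r.
  by apply/eqP; rewrite eq_le hle -oppr_le0 -linearN hle.
exists m.+1, (ord_cons ((h ounit)^-1 \*: h : {linear V -> R^o}) g),
  (ord_cons (h ounit *: w) ws); split.
- move=> i; case: (unliftP ord0 i) => [j|] ->; rewrite !ord_consE //.
  split=> [v pv|]; first by apply: mulr_ge0; [rewrite invr_ge0 | exact: hpos].
  by rewrite /= -[_ *: _]/(_ * _) mulVf.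
- move=> i; case: (unliftP ord0 i) => [j|] ->; rewrite !ord_consE //.
  exact: posconeZ.
move=> v ev; rewrite big_cons linearD contractE -hE //= gw //
  big_ord_recl !ord_consE.
congr (_ + _); last by apply: eq_bigr => i _; rewrite !ord_consE.
by rewrite /= scalerA -[_ *: h v]/(_ * h v) mulrAC mulVf // mul1r.
Qed.

End DualSystem.

(** * Unital positive maps into and out of finite-dimensional l^oo *)

Section LinfMaps.
Variables (R : realType) (V : functionSystemType R) (n : nat).
Variables (g : 'I_n -> {linear V -> R^o}) (w : 'I_n -> V).

Definition linf_row (v : V) : linf R n := (\row_i g i v : 'rV[R]_n).

Fact linf_row_is_linear : linear linf_row.
Proof. by move=> a v v'; apply/rowP => i; rewrite !mxE linearP. Qed.

HB.instance Definition _ :=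
  GRing.isLinear.Build R V (linf R n) *:%R linf_row linf_row_is_linear.

Lemma linf_row_unital_positive :
  (forall i, is_state (g i)) -> unital_positive linf_row.
Proof.
move=> gs; split=> [v pv i|]; first by rewrite mxE; apply: (gs i).1.
by apply/rowP => i; rewrite !mxE; exact: (gs i).2.
Qed.

Definition linf_comb (x : linf R n) : V := \sum_i (x : 'rV[R]_n) 0 i *: w i.

Fact linf_comb_is_linear : linear linf_comb.
Proof.
move=> a x y; rewrite /linf_comb scaler_sumr -big_split /=.
by apply: eq_bigr => i _; rewrite !mxE scalerDl scalerA.
Qed.

HB.instance Definition _ :=
  GRing.isLinear.Build R (linf R n) V *:%R linf_comb linf_comb_is_linear.

Lemma linf_comb_unital_positive :
  (forall i, poscone (w i)) -> \sum_i w i = ounit -> unital_positive linf_comb.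
Proof.
move=> wpos wsum; split=> [x px|].
  rewrite /= /linf_comb.
  elim/big_ind: _ => [|? ?|i _]; [exact: poscone0 | exact: posconeD |].
  exact: posconeZ (px i) (wpos i).
by rewrite -wsum; apply: eq_bigr => i _; rewrite mxE scale1r.
Qed.

End LinfMaps.

(** * Approximate factorization on finitely many vectors *)

Lemma two_sided_bound_seq (R : realType) (V : functionSystemType R) (s : seq V) :
  exists2 r : R, 0 < r &
    forall v, v \in s -> poscone (r *: ounit + v) /\ poscone (r *: ounit - v).
Proof.
have unit_pos (r : R) : 0 < r -> poscone (r *: ounit : V).
  by move=> /ltW r0; exact: posconeZ r0 (poscone_ounit V).
elim: s => [|v s [r r0 hr]]; first by exists 1.
have [t t0 [v1 v2]] := two_sided_bound v.
exists (r + t) => [|x]; first exact: addr_gt0.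
rewrite scalerDl inE => /orP[/eqP->|/hr[x1 x2]].
  by rewrite -!addrA; split; apply: posconeD => //; exact: unit_pos.
by split; rewrite addrAC; apply: posconeD => //; exact: unit_pos.
Qed.

Section Approximation.
Variables (R : realType) (V W : functionSystemType R) (Phi : {linear V -> W}).
Hypothesis Phi_unital : Phi ounit = ounit.
Hypothesis Phi_min_max : forall E : functionSystemType R,
  finite_dimensional E -> min_max_positive E Phi.

Lemma linf_approximation (s : seq V) (d : R) : 0 < d ->
  exists m (phi : {linear V -> linf R m}) (psi : {linear linf R m -> W}),
    [/\ unital_positive phi, unital_positive psi &
        forall v, v \in s -> `|order_norm (psi (phi v) - Phi v)| <= d].
Proof.
move=> d0; have [n [f [u [fs fu es]]]] := biorthogonal_system (ounit :: s).
have eu : expands f u ounit by apply: es; exact: mem_head.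
(* The direction of the error: with [k] below, psi (phi v) - Phi v = (k e) y(v). Here n is the value
   of the sum of the f_i at the order unit. *)
pose y v : W := (\sum_i f i v) *: ounit - n%:R *: Phi v.
have [r r0 hr] := two_sided_bound_seq [seq y v | v <- s].
pose e := d / r; have e0 : 0 < e by exact: divr_gt0.
have := Phi_min_max (dual_system_finite fs fu eu)
  (@min_cone_inclusion _ _ _ _ _ fs fu eu) e0.
move=> /contract_alg_cone[m [g [w [gs wpos gw]]]].
(* Contracting at [v] sends the image of [inclusion] to Phi v, and the added e times the unit to e
   (sum_i f_i(v)) times the unit of W. *)
have {}gw v : expands f u v ->
    \sum_i g i v *: w i = Phi v + (e * \sum_i f i v) *: ounit.
  move=> ev; rewrite -gw // linearD linearZ_LR /= contractE.
  rewrite dual_ounitE pairing_const scalerA.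
  have -> : tensor_map idfun Phi (inclusion fs fu eu) =
      \sum_i dual_basis fs fu eu i *t Phi (u i).
    by rewrite linear_sum; apply: eq_bigr => i _; rewrite tensor_mapE.
  have -> : Phi v = \sum_i f i v *: Phi (u i).
    by rewrite {1}ev linear_sum; apply: eq_bigr => i _; rewrite linearZ.
  rewrite linear_sum; congr (_ + _).
  by apply: eq_bigr => i _; rewrite contractE pairing_delta.
(* At the order unit, [gw] shows that the w_i sum to 1 + e n times the unit, so the factor [k] makes
   psi unital. *)
pose k := (1 + e * n%:R)^-1.
have en0 : 0 <= e * n%:R by rewrite mulr_ge0 ?ler0n // ltW.
have k0 : 0 < k by rewrite invr_gt0 ltr_wpDr.
have k1 : k <= 1 by rewrite invf_le1 ?lerDl // ltr_wpDr.
have kE : k * (1 + e * n%:R) = 1 by rewrite mulVf // gt_eqF // ltr_wpDr.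
exists m, (linf_row g), (linf_comb (fun i => k *: w i)); split.
- exact: linf_row_unital_positive.
- apply: linf_comb_unital_positive => [i|]; first exact: posconeZ (ltW k0)
    (wpos i).
  have := gw _ eu; under eq_bigr do rewrite (gs _).2 scale1r.
  rewrite -scaler_sumr => ->; rewrite Phi_unital.
  under eq_bigr do rewrite (fs _).2.
  by rewrite sumr_const card_ord -[X in X + _]scale1r -scalerDl scalerA kE
    scale1r.
move=> v vs; have ev : expands f u v by apply: es; rewrite inE vs orbT.
have -> : linf_comb (fun i => k *: w i) (linf_row g v) - Phi v = (k * e) *: y v.
  have -> : linf_comb (fun i => k *: w i) (linf_row g v) =
      k *: \sum_i g i v *: w i.
    by rewrite scaler_sumr; apply: eq_bigr => i _; rewrite mxE !scalerA mulrC.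
  rewrite gw // -[X in _ - X]scale1r -kE -[X in _ - X]scalerA -scalerBr.
  rewrite -[RHS]scalerA; congr (_ *: _).
  by rewrite scalerDl scale1r opprD addrACA subrr add0r scalerBr !scalerA.
have [y1 y2] := hr (y v) (map_f _ vs).
have ke0 : 0 <= k * e by rewrite mulr_ge0 ?ltW.
(* As e r = d and k <= 1, the bound r for y(v) turns into k e r <= d for the error. *)
have dr : 0 <= d - k * e * r.
  by rewrite subr_ge0 -mulrA /e divfK ?gt_eqF // ger_pMl.
have scaled (x : W) :
    poscone (r *: ounit + x) -> poscone (d *: ounit + (k * e) *: x).
  move=> /(posconeZ _ _ ke0); rewrite scalerDr scalerA => px.
  have := posconeD _ _ (posconeZ _ _ dr (poscone_ounit W)) px.
  by rewrite addrA -scalerDl subrK.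
by apply: order_norm_le; rewrite // -?scalerN; exact: scaled.
Qed.

End Approximation.

(** * Construction of the net and the cycle of implications *)

Theorem theorem4p3 (R : realType) (V W : functionSystemType R)
    (Phi : {linear V -> W}) (hPhi : unital_positive Phi) :
  ((forall A : functionSystemType R, min_max_positive A Phi) <->
   (forall E : functionSystemType R,
      finite_dimensional E -> min_max_positive E Phi)) /\
  ((forall E : functionSystemType R,
      finite_dimensional E -> min_max_positive E Phi) <->
   (exists (I : Type) (le : I -> I -> Prop) (n : I -> nat)
      (phi : forall i, {linear V -> linf R (n i)})
      (psi : forall i, {linear linf R (n i) -> W}),
      [/\ directed_preorder le,
          forall i, unital_positive (phi i),
          forall i, unital_positive (psi i)
        & forall v : V,
            net_to0 le (fun i => order_norm (psi i (phi i v) - Phi v))])).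
Proof.
set fin := forall E, _ -> _; set net := exists I, _.
have fin_net : fin -> net.
  move=> hfin.
  (* An index is a finite list of test vectors with a natural number k, which stands for the
     tolerance 1 / (k + 1), positive for k = 0 too. *)
  pose le (i j : seq V * nat) := {subset i.1 <= j.1} /\ (i.2 <= j.2)%N.
  have approx (i : seq V * nat) := cid (linf_approximation hPhi.2 hfin i.1
    (ltac:(by rewrite invr_gt0 ltr0n) : 0 < i.2.+1%:R^-1)).
  pose n i := projT1 (approx i).
  have phi_psi i := cid (projT2 (approx i)).
  pose phi i : {linear V -> linf R (n i)} := projT1 (phi_psi i).
  have psiP i := cid (projT2 (phi_psi i)).
  exists (seq V * nat)%type, le, n, phi, (fun i => projT1 (psiP i)).
  split=> [|i|i|v e e0].
  - split.
    + by constructor; exact: ([::], 0%N).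
    + by move=> i; split.
    + move=> i j k [ij1 ij2] [jk1 jk2]; split; last exact: leq_trans jk2.
      by move=> x /ij1/jk1.
    + move=> i j; exists (i.1 ++ j.1, maxn i.2 j.2);
        rewrite /le /= leq_maxl leq_maxr.
      by split; split=> // x xi; rewrite mem_cat xi ?orbT.
  - by case: (projT2 (psiP i)).
  - by case: (projT2 (psiP i)).
  (* N exceeds 1 / e, hence 1 / (k + 1) < e for all k >= N. *)
  pose N := Num.bound e^-1; exists ([:: v], N) => i [/= vi Ni].
  have [_ _ h] := projT2 (psiP i).
  apply: le_lt_trans (h v _) _; first by apply: vi; exact: mem_head.
  rewrite invf_plt ?posrE ?ltr0n //.
  apply: lt_le_trans (archi_boundP _) _; first by rewrite invr_ge0 ltW.
  by rewrite ler_nat (leq_trans Ni).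
have net_all : net -> forall A : functionSystemType R, min_max_positive A Phi.
  by move=> [I [le [n [phi [psi [dir hphi hpsi conv]]]]]] A;
    exact: factorization_min_max conv.
split; split; [by move=> h E _|by move=> /fin_net/net_all|exact: fin_net|].
by move=> /net_all h E _.
Qed.
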